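(* Let $E$ be a real reflexive Banach space with norm $\|\cdot\|$, and let $$\Phi(x)=\frac12\|x\|^{2}-I(x),\qquad x\in E,$$ be of class $C^1$ on $E$, where $I\in C^{1}(E,\mathbb{R})$ satisfies the following conditions: (i) $I$ is weakly continuous; (ii) $\lim_{x\to 0}\frac{I(x)}{\|x\|^{2}}=0$; (iii) $\frac{I(sx)}{s^{2}}\to+\infty$ as $s\to+\infty$, uniformly for $x$ on weakly compact subsets of $E\setminus\{0\}$; (iv) for every $x\neq 0$, the function $s\mapsto\frac{I'(sx)x}{s}$ is non-decreasing in $s>0$. Then there is a critical point $\bar{x}$ of $\Phi$ such that $$\Phi(\bar{x})=\max_{s\ge 0}\Phi(s\bar{x})=\inf_{\|e\|=1}\max_{s\ge 0}\Phi(se)=\inf_{x\in\mathcal{N}}\Phi(x)>0,$$ where $\mathcal{N}=\{x\in E\setminus\{0\}\mid \Phi'(x)x=0\}$.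
   Context: $\Phi'(x)\in E^*$ denotes the Fréchet derivative of $\Phi$ at $x$, and $\Phi'(x)y$ its value on $y\in E$ (similarly for $I'$). A critical point of $\Phi$ is a point $x\in E$ with $\Phi'(x)=0$. Weak continuity is used in the sequential sense: $x_k\rightharpoonup x$ in $E$ implies $I(x_k)\to I(x)$. The set $\mathcal{N}$ is called the Nehari manifold of $\Phi$ (it need not be a manifold). *)

(* Defs.v *)
From HB Require Import structures.
From mathcomp Require Import all_boot all_order all_algebra.
From mathcomp Require Import all_classical all_reals all_analysis.

Set Implicit Arguments.
Unset Strict Implicit.
Unset Printing Implicit Defensive.

Import Order.TTheory GRing.Theory Num.Theory.
Import numFieldNormedType.Exports.

Local Open Scope classical_set_scope.
Local Open Scope ring_scope.

(** The topological dual of [E] is represented as a subset of the module of all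
    functions [E -> R^o], whose pointwise operations it inherits. *)
Definition dual (R : realType) (E : normedModType R) : set (E -> R^o) :=
  [set f | linear f /\ continuous f].

Definition dual_norm (R : realType) (E : normedModType R) (f : E -> R^o) : R :=
  sup [set `|f x| | x in [set x : E | `|x| <= 1]].

(** An element of the bidual is given by a function [G] of which only the values on
    [dual E] matter. *)
Definition bidual (R : realType) (E : normedModType R) :
    set ((E -> R^o) -> R) :=
  [set G | (forall (a : R) (f g : E -> R^o), dual f -> dual g ->
              G (a *: f + g) = a * G f + G g) /\
           (exists C : R, forall f : E -> R^o, dual f ->
              `|G f| <= C * dual_norm f)].

Definition reflexive_space (R : realType) (E : normedModType R) : Prop :=
  forall G : (E -> R^o) -> R, @bidual R E G ->
    exists x : E, forall f : E -> R^o, dual f -> G f = f x.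

(** [weak E] is [E] with the topology sigma(E, dual E), i.e. the initial topology
    for the evaluation map into the product of copies of [R] indexed by [dual E]. *)
Definition dual_eval (R : realType) (E : normedModType R) (x : E) :
  {ptws {f : E -> R^o | dual f} -> R^o} := fun f => sval f x.

Definition weak (R : realType) (E : normedModType R) : topologicalType :=
  initial_topology (@dual_eval R E).

Definition weakly_cvg (R : realType) (E : normedModType R)
  (u : nat -> E) (x : E) : Prop := (u : nat -> weak E) @ \oo --> (x : weak E).

Definition weakly_compact (R : realType) (E : normedModType R) (K : set E) :
  Prop := @compact (weak E) K.

Definition weakly_seq_continuous (R : realType) (E : normedModType R)
    (f : E -> R^o) : Prop :=
  forall (u : nat -> E) (x : E), weakly_cvg u x -> f (u k) @[k --> \oo] --> f x.

Definition class_C1 (R : realType) (E : normedModType R) (f : E -> R^o) : Prop :=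
  (forall x : E, differentiable f x) /\
  (forall x : E, dual_norm (fun v => 'd f y v - 'd f x v) @[y --> x] --> (0 : R)).

Definition energy (R : realType) (E : normedModType R) (I : E -> R^o) :
  E -> R^o := fun x => 2^-1 * `|x| ^+ 2 - I x.

Definition critical_point (R : realType) (E : normedModType R)
  (f : E -> R^o) (x : E) : Prop := forall v : E, 'd f x v = 0.

Definition nehari (R : realType) (E : normedModType R) (f : E -> R^o) : set E :=
  [set x | x != 0 /\ 'd f x x = 0].

Definition ray_values (R : realType) (E : normedModType R) (f : E -> R^o)
  (x : E) : set R := [set f (s *: x) | s in [set s : R | 0 <= s]].

(** At most one element; empty when the maximum is not attained. *)
Definition maximums (R : realType) (A : set R) : set R := A `&` ubound A.

(* Main.v *)
Require Import Defs.
From HB Require Import structures.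
From mathcomp Require Import finmap.
From mathcomp Require Import all_boot all_order all_algebra.
From mathcomp Require Import all_classical all_reals all_analysis.
From mathcomp Require Import ring lra.
Import Order.TTheory GRing.Theory Num.Theory.
Import numFieldNormedType.Exports.
Local Open Scope classical_set_scope.
Local Open Scope ring_scope.

(** Along every ray [s |-> Phi (s x)] the derivative divided by [s] is non-increasing, so points
    of the Nehari set are maxima of their rays, and every ray meets that set. Let [e_n] be unit
    vectors whose ray maxima tend to the infimum [c]. A weak sequential limit [e] of a
    subsequence satisfies [s^2 / 2 - I (s e) <= c] for all [s >= 0]; hence [e <> 0] and
    its ray maximum is [c].

    Under weak monotonicity the maximum on the ray of a minimizer [x] may be attained on a whole
    segment, of which only some point is claimed to be critical. Otherwise there is a
    continuous field [V] with [Phi'(s x) (V s) < 0] whenever [Phi (s x) = c]; the path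
    [s |-> s x + t (V s)] still crosses the Nehari set for small [t > 0], but at a level
    below [c]. *)

Set Implicit Arguments.
Unset Strict Implicit.
Unset Printing Implicit Defensive.

(** * The Hahn-Banach theorem *)

(** Homogeneity is only an inequality for [0 < t], which passes directly to infima; equality and the
    value at [0] follow. *)
Definition sublinear (R : realType) (V : lmodType R) (p : V -> R) : Prop :=
  (forall x y, p (x + y) <= p x + p y) /\
  (forall t x, 0 < t -> p (t *: x) <= t * p x).

Lemma sublinear0 (R : realType) (V : lmodType R) (p : V -> R) :
  sublinear p -> p 0 = 0.
Proof.
move=> [_ pZ].
have h1 := pZ 2 0 ltac:(lra); have h2 := pZ 2^-1 0 ltac:(lra).
rewrite !scaler0 in h1 h2; lra.
Qed.

Lemma sublinearZ (R : realType) (V : lmodType R) (p : V -> R) t x :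
  sublinear p -> 0 <= t -> p (t *: x) = t * p x.
Proof.
move=> sp; rewrite le_eqVlt => /predU1P[<-|t0].
  by rewrite scale0r mul0r sublinear0.
have [_ pZ] := sp.
apply/eqP; rewrite eq_le pZ //=.
have := pZ t^-1 (t *: x); rewrite invr_gt0 => /(_ t0).
rewrite scalerA mulVf ?gt_eqF// scale1r => h.
by rewrite mulrC -ler_pdivlMr// mulrC.
Qed.

Lemma sublinearN (R : realType) (V : lmodType R) (p : V -> R) x :
  sublinear p -> - p (- x) <= p x.
Proof.
move=> sp; have [pD _] := sp.
by have := pD x (- x); rewrite subrr sublinear0//; lra.
Qed.

(** The lowering of a sublinear [p] along [y]: it stays sublinear and at most [p], while its value
    at [- y] drops to at most [- p y]. *)
Definition sublinear_along (R : realType) (V : lmodType R) (p : V -> R) (y x : V) : R :=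
  inf [set p (x + t *: y) - t * p y | t in [set t | 0 <= t]].

Section sublinear_along.
Variables (R : realType) (V : lmodType R) (p : V -> R) (y : V).
Hypothesis sp : sublinear p.

Lemma sublinear_along_le t x : 0 <= t ->
  sublinear_along p y x <= p (x + t *: y) - t * p y.
Proof.
move=> t0; apply: ge_inf; last by exists t.
exists (- p (- x)) => _ [s s0 <-].
have [pD _] := sp.
have := pD (x + s *: y) (- x).
by rewrite addrC addKr sublinearZ//; lra.
Qed.

Lemma le_sublinear_along r x :
  (forall t, 0 <= t -> r <= p (x + t *: y) - t * p y) ->
  r <= sublinear_along p y x.
Proof.
move=> h; apply: lb_le_inf; first by exists (p (x + 0 *: y) - 0 * p y), 0 => /=.
by move=> _ [t t0 <-]; exact: h.
Qed.

Lemma sublinear_along_sublinear : sublinear (sublinear_along p y).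
Proof.
have [pD _] := sp.
split=> [x x'|t x t0].
  rewrite -lerBlDr; apply: le_sublinear_along => s s0.
  rewrite lerBlDr -lerBlDl; apply: le_sublinear_along => t t0.
  have := @sublinear_along_le (s + t) (x + x') (addr_ge0 s0 t0).
  have := pD (x + s *: y) (x' + t *: y).
  by rewrite addrACA -scalerDl; lra.
rewrite mulrC -ler_pdivrMr//; apply: le_sublinear_along => s s0.
rewrite ler_pdivrMr//.
have ts0 : 0 <= t * s by rewrite mulr_ge0// ltW.
have := sublinear_along_le (t *: x) ts0.
rewrite -scalerA -scalerDr (sublinearZ _ sp (ltW t0)); lra.
Qed.

Lemma sublinear_along_id x : sublinear_along p y x <= p x.
Proof. by have := sublinear_along_le x (lexx 0); rewrite scale0r addr0 mul0r subr0. Qed.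

Lemma sublinear_alongN : sublinear_along p y (- y) <= - p y.
Proof.
have := sublinear_along_le (- y) ler01.
by rewrite scale1r addNr mul1r sublinear0// sub0r.
Qed.

End sublinear_along.

(* Minimality forces [q] to equal its modification along any [y], which gives
   [q (x + y) >= q x + q y]. *)
Lemma minimal_sublinear_linear (R : realType) (V : lmodType R) (q : V -> R) :
  sublinear q -> (forall q', sublinear q' -> (forall x, q' x <= q x) -> q' = q) ->
  forall a x y, q (a *: x + y) = a * q x + q y.
Proof.
move=> sq qmin.
have qD x y : q (x + y) = q x + q y.
  apply/eqP; rewrite eq_le (proj1 sq)/=.
  have E := qmin _ (sublinear_along_sublinear y sq) (sublinear_along_id y sq).
  have := sublinear_along_le y sq x ler01.
  by rewrite E scale1r mul1r; lra.
have qN x : q (- x) = - q x.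
  by have := qD x (- x); rewrite subrr sublinear0//; lra.
move=> a x y; rewrite qD; congr (_ + _).
have [a0|a0] := leP 0 a; first exact: sublinearZ.
have : q ((- a) *: x) = - a * q x by apply: sublinearZ => //; lra.
by rewrite scaleNr qN; lra.
Qed.

(** Zorn's lemma for the reversed pointwise order. The infimum of a chain is subadditive because, of
    any two members, the smaller one serves at both points. *)
Lemma exists_minimal_sublinear (R : realType) (V : lmodType R) (p : V -> R) :
  sublinear p -> exists q, [/\ sublinear q, forall x, q x <= p x &
    forall q', sublinear q' -> (forall x, q' x <= q x) -> q' = q].
Proof.
move=> sp.
pose T := {q : V -> R | sublinear q /\ forall x, q x <= p x}.
pose below (q r : T) := `[< forall x, sval r x <= sval q x >].
have [|||A Atot|[q [sq qp]] qmin] := @Zorn T below.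
- by move=> q; apply/asboolP.
- move=> q r s /asboolP qr /asboolP rs; apply/asboolP => x.
  exact: le_trans (rs x) (qr x).
- move=> [q hq] [r hr] /asboolP qr /asboolP rq; apply: eq_exist => /=.
  by apply/funext => x; apply/eqP; rewrite eq_le (rq x) (qr x).
- have [[q0 Aq0]|A0] := pselect (exists q, A q); last first.
    by exists (exist _ p (conj sp (fun x => lexx (p x)))) => q Aq; case: A0; exists q.
  pose m x := inf [set sval q x | q in A].
  have m_le q x : A q -> m x <= sval q x.
    move=> Aq; apply: ge_inf; last by exists q.
    (* Each member [r] of the chain satisfies [- p (- x) <= - r (- x) <= r x]. *)
    exists (- p (- x)) => _ [[r [sr rp]] Ar <-] /=.
    by apply: le_trans (sublinearN x sr); rewrite lerN2.
  have le_m r x : (forall q, A q -> r <= sval q x) -> r <= m x.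
    move=> h; apply: lb_le_inf; first by exists (sval q0 x), q0.
    by move=> _ [q Aq <-]; exact: h.
  have sm : sublinear m.
    split=> [x y|t x t0].
      rewrite -lerBlDr; apply: (le_m) => q Aq.
      rewrite lerBlDr -lerBlDl; apply: (le_m) => r Ar; rewrite lerBlDl.
      have [/asboolP qr|/asboolP rq] := Atot _ _ Aq Ar.
        apply: le_trans (m_le r _ Ar) _.
        apply: le_trans (proj1 (proj1 (svalP r)) x y) _.
        by rewrite lerD2r.
      apply: le_trans (m_le q _ Aq) _.
      apply: le_trans (proj1 (proj1 (svalP q)) x y) _.
      by rewrite lerD2l.
    rewrite mulrC -ler_pdivrMr//; apply: (le_m) => q Aq; rewrite ler_pdivrMr//.
    apply: le_trans (m_le q _ Aq) _; rewrite mulrC.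
    exact: (proj2 (proj1 (svalP q))).
  have mp x : m x <= p x.
    exact: le_trans (m_le q0 x Aq0) (proj2 (svalP q0) x).
  exists (exist _ m (conj sm mp)) => q Aq; apply/asboolP => x /=.
  exact: m_le.
- exists q; split=> // q' sq' q'q.
  have q'p x : q' x <= p x by exact: le_trans (q'q x) (qp x).
  suff /(congr1 sval) : exist _ q' (conj sq' q'p) = exist _ q (conj sq qp) :> T by [].
  by apply: qmin; apply/asboolP.
Qed.

(** A minimal sublinear functional below [sublinear_along p z] is linear; its value at [- z] is at
    most [- p z], which forces equality at [z]. *)
Lemma hahn_banach (R : realType) (V : lmodType R) (p : V -> R) (z : V) :
  sublinear p -> exists f : V -> R,
    [/\ forall a x y, f (a *: x + y) = a * f x + f y, forall x, f x <= p x &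
       f z = p z].
Proof.
move=> sp.
have [q [sq qp qmin]] := exists_minimal_sublinear (sublinear_along_sublinear z sp).
have qlin := minimal_sublinear_linear sq qmin.
have le_qp x : q x <= p x := le_trans (qp x) (sublinear_along_id z sp x).
exists q; split=> //; apply/eqP; rewrite eq_le le_qp/=.
have := le_trans (qp (- z)) (sublinear_alongN z sp).
have := qlin (-1) z 0; rewrite (sublinear0 sq) scaleN1r !addr0; lra.
Qed.

(** * Continuous linear functionals *)

Section dual.
Variables (R : realType) (E : normedModType R).
Implicit Types (f g : E -> R^o) (x y z : E).

Lemma bounded_linear_dual f (C : R) :
  (forall a x y, f (a *: x + y) = a * f x + f y) ->
  (forall x, `|f x| <= C * `|x|) -> dual f.
Proof.
move=> fl fC; split; first by move=> a x y; exact: fl.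
have fB x y : f x - f y = f (x - y).
  by have := fl (-1) y x; rewrite scaleN1r addrC => ->; lra.
move=> x; apply/cvgrPdist_lt => e e0.
have C1 : 0 < `|C| + 1 by rewrite ltr_wpDl.
near=> y; rewrite fB; apply: le_lt_trans (fC _) _.
apply: (@le_lt_trans _ _ ((`|C| + 1) * `|x - y|)).
  by rewrite ler_wpM2r//; have := ler_norm C; lra.
rewrite mulrC -ltr_pdivlMr//.
near: y; apply: cvgr_dist_lt; [exact: cvg_id|by rewrite divr_gt0].
Unshelve. all: by end_near. Qed.

Lemma dual_linear f : dual f -> forall a x y, f (a *: x + y) = a * f x + f y.
Proof. by move=> [fl _] a x y; exact: fl. Qed.

Lemma dual0 f : dual f -> f 0 = 0.
Proof. by move=> df; have := dual_linear df 1 0 0; rewrite scaler0 addr0; lra. Qed.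

Lemma dualZ f a x : dual f -> f (a *: x) = a * f x.
Proof. by move=> df; have := dual_linear df a x 0; rewrite addr0 dual0// addr0. Qed.

Lemma dualB f x y : dual f -> f (x - y) = f x - f y.
Proof. by move=> df; have := dual_linear df (-1) y x; rewrite scaleN1r addrC; lra. Qed.

Lemma dual_bounded f : dual f -> exists2 C : R, 0 < C & forall x, `|f x| <= C * `|x|.
Proof.
move=> df; have [_ /(_ 0)] := df; rewrite /continuous_at dual0// => /cvgrPdist_lt /(_ _ ltr01).
move=> /nbhs_ballP[r /= r0 rf].
(* [|f|] is below 1 on the ball of radius [r]; [x] is rescaled to norm [r / 2] to lie in it. *)
exists (2 / r); first by rewrite divr_gt0.
move=> x; have [->|x0] := eqVneq x 0; first by rewrite dual0// !normr0 mulr0.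
have nx0 : 0 < `|x| by rewrite normr_gt0.
have k0 : 0 < r / 2 / `|x| by rewrite !divr_gt0.
have := rf ((r / 2 / `|x|) *: x).
rewrite -ball_normE /= !sub0r !normrN (dualZ _ _ df) normrZ (gtr0_norm k0) normrM (gtr0_norm k0).
rewrite divfK ?gt_eqF// => /(_ ltac:(lra)).
rewrite -ltr_pdivlMl//.
move=> /ltW /le_trans; apply; rewrite mulr1 !invf_div le_eqVlt; apply/orP; left; apply/eqP.
by field; rewrite gt_eqF.
Qed.

Lemma dual_norm_ge f x : dual f -> `|f x| <= dual_norm f * `|x|.
Proof.
move=> df; have [->|x0] := eqVneq x 0; first by rewrite dual0// !normr0 mulr0.
have nx0 : 0 < `|x| by rewrite normr_gt0.
rewrite -ler_pdivrMr// mulrC -[(`|x|^-1)]gtr0_norm ?invr_gt0// -normrM -dualZ//.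
have [C C0 fC] := dual_bounded df.
apply: ub_le_sup.
  exists C => _ [y /= y1 <-]; apply: le_trans (fC y) _.
  by rewrite ler_piMr// ltW.
by exists (`|x|^-1 *: x) => //=; rewrite normrZ normfV normr_id mulVf ?gt_eqF.
Qed.

Lemma dual_norm_ge0 f : dual f -> 0 <= dual_norm f.
Proof.
move=> df; have [C C0 fC] := dual_bounded df.
apply: (@le_trans _ _ `|f 0|); first by [].
apply: ub_le_sup; last by exists 0 => //=; rewrite normr0.
exists C => _ [y /= y1 <-]; apply: le_trans (fC y) _.
by rewrite ler_piMr// ltW.
Qed.

Lemma norming_functional z : exists f, [/\ dual f, forall x, `|f x| <= `|x| & f z = `|z|].
Proof.
have [|f [fl fn fz]] := @hahn_banach R E (fun x => `|x|) z.
  by split=> [x y|t x t0]; [exact: ler_normD|rewrite normrZ gtr0_norm].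
have fN x : f (- x) = - f x.
  have f0 : f 0 = 0 by have := fl 1 0 0; rewrite scaler0 addr0; lra.
  by have := fl (-1) x 0; rewrite scaleN1r !addr0 f0; lra.
have fC x : `|f x| <= `|x|.
  by rewrite ler_norml fn andbT lerNl -fN -(normrN x).
by exists f; split=> //; apply: (@bounded_linear_dual _ 1) => // x; rewrite mul1r.
Qed.

(** Hahn-Banach for the distance to the subspace [Z], which is sublinear, vanishes on [Z] and is at
    least [e] at [z]. *)
Lemma separating_functional (Z : set E) z (e : R) :
  Z 0 -> (forall a x y, Z x -> Z y -> Z (a *: x + y)) ->
  0 < e -> (forall y, Z y -> e <= `|z - y|) ->
  exists f, [/\ dual f, forall y, Z y -> f y = 0 & f z != 0].
Proof.
move=> Z0 ZL e0 eZ.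
pose p x := inf [set `|x - y| | y in Z].
have p_le x y : Z y -> p x <= `|x - y|.
  by move=> Zy; apply: ge_inf; [exists 0 => _ [w _ <-]|exists y].
have le_p r x : (forall y, Z y -> r <= `|x - y|) -> r <= p x.
  move=> h; apply: lb_le_inf; first by exists `|x - 0|, 0.
  by move=> _ [y Zy <-]; exact: h.
have sp : sublinear p.
  split=> [x y|t x t0].
    rewrite -lerBlDr; apply: (le_p) => u Zu; rewrite lerBlDr -lerBlDl.
    apply: (le_p) => v Zv; rewrite lerBlDl.
    apply: le_trans (p_le _ (u + v) _) _; first by rewrite -[u]scale1r; exact: ZL.
    by rewrite opprD addrACA ler_normD.
  rewrite mulrC -ler_pdivrMr//; apply: (le_p) => y Zy; rewrite ler_pdivrMr//.
  apply: le_trans (p_le _ (t *: y) _) _.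
    by rewrite -[t *: y]addr0; exact: ZL.
  by rewrite -scalerBr normrZ gtr0_norm// mulrC.
have [f [fl fp fz]] := hahn_banach z sp.
have f0 : f 0 = 0 by have := fl 1 0 0; rewrite scaler0 addr0; lra.
have fN x : f (- x) = - f x by have := fl (-1) x 0; rewrite scaleN1r !addr0 f0; lra.
exists f; split.
- apply: (@bounded_linear_dual _ 1) => // x; rewrite mul1r.
  have pn y : p y <= `|y| by rewrite -{2}[y]subr0; exact: p_le.
  rewrite ler_norml (le_trans (fp x))// andbT lerNl -fN -(normrN x).
  exact: le_trans (fp _) (pn _).
- have le0 y : Z y -> f y <= 0.
    by move=> Zy; apply: le_trans (fp y) _; rewrite -(normr0 E) -(subrr y); exact: p_le.
  move=> y Zy; apply/eqP; rewrite eq_le le0//= -oppr_le0 -fN le0//.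
  by rewrite -scaleN1r -[_ *: _]addr0; exact: ZL.
- by rewrite fz gt_eqF//; apply: lt_le_trans e0 _; exact: le_p.
Qed.

(** * Weak limits along sequences and ultrafilters *)

Lemma weakly_cvgP (u : nat -> E) x :
  (forall f, dual f -> f (u n) @[n --> \oo] --> f x) -> weakly_cvg u x.
Proof.
move=> h.
have : {ptws, (@dual_eval R E (u n)) @[n --> \oo] --> @dual_eval R E x}.
  apply/cvg_sup => -[f df] A /= [_ [[B Bo <-] Bx] BA].
  by apply: (filterS BA); apply: h => //; exact: open_nbhs_nbhs.
move=> cu A [_ [[B Bo <-] Bx BA]].
by apply: (filterS BA); apply: cu; exact: open_nbhs_nbhs.
Qed.

(** An ultrafilter on the compact segment [[- C, C]] has a cluster point and converges to it. *)
Lemma ultra_cvg (u : nat -> R) (U : set_system nat) (C : R) :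
  UltraFilter U -> (forall n, `|u n| <= C) -> exists l : R, u n @[n --> U] --> l.
Proof.
move=> UU uC.
have PU : ProperFilter U := @ultra_proper _ _ UU.
have [|p [_ up]] := @segment_compact R (- C) C (u @ U) _.
  by apply: (@filterE _ U) => n /=; rewrite in_itv/= -ler_norml.
exists p => A Ap; have [//|UnA] := in_ultra_setVsetC (u @^-1` A) UU.
by have [y [nA Ay]] := up (~` A) A UnA Ap; case: nA.
Qed.

(** The limits of [f (u n)] along [U] depend linearly and boundedly on [f], so they form an element
    of the bidual, which reflexivity represents by a point. *)
Lemma reflexive_ultra_weak_limit (u : nat -> E) (U : set_system nat) (C : R) :
  reflexive_space E -> UltraFilter U -> (forall n, `|u n| <= C) ->
  exists x, forall f, dual f -> f (u n) @[n --> U] --> f x.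
Proof.
move=> rE UU uC.
have PU : ProperFilter U := @ultra_proper _ _ UU.
have uG f : dual f -> f (u n) @[n --> U] --> lim (f (u n) @[n --> U]).
  move=> df; have [D D0 fD] := dual_bounded df.
  have [|l ul] := @ultra_cvg (fun n => f (u n)) U (D * C) UU.
    by move=> n; apply: le_trans (fD _) _; rewrite ler_wpM2l// ltW.
  by apply/cvg_ex; exists l.
pose G (f : E -> R^o) : R := lim (f (u n) @[n --> U]).
have [|x Gx] := rE G; last by exists x => f df; rewrite -Gx//; exact: uG.
split=> [a f g df dg|].
  apply: cvg_lim => //; apply: cvgD; last exact: uG.
  by apply: cvgMl_tmp; exact: uG.
exists C => f df.
rewrite /G -lim_norm; last by apply/cvg_ex; eexists; exact: uG.
apply: limr_le; first by apply/cvg_ex; eexists; apply: cvg_norm; exact: uG.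
apply: filterE => n; apply: le_trans (dual_norm_ge _ df) _.
rewrite mulrC ler_wpM2r//.
exact: dual_norm_ge0.

Qed.
End dual.

(** * Weakly convergent subsequences *)

Section rat_span.
Variables (R : realType) (E : normedModType R) (u : nat -> E).

(** Coefficients are rational so that the combinations are countably many, indexed by [pickle];
    their closure is nevertheless a real subspace. *)
Definition rat_comb (s : seq (rat * nat)) : E := \sum_(p <- s) ratr p.1 *: u p.2.

Definition closed_span : set E :=
  [set v | forall e : R, 0 < e -> exists s, `|v - rat_comb s| < e].

Lemma closed_span_mem n : closed_span (u n).
Proof.
move=> e e0; exists [:: (1, n)].
by rewrite /rat_comb big_seq1 rmorph1 scale1r subrr normr0.
Qed.

Lemma closed_span0 : closed_span 0.
Proof. by move=> e e0; exists [::]; rewrite /rat_comb big_nil subrr normr0. Qed.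

Lemma closed_span_closed v :
  (forall e : R, 0 < e -> exists2 w, closed_span w & `|v - w| < e) -> closed_span v.
Proof.
move=> h e e0; have e20 : 0 < e / 2 by rewrite divr_gt0.
have [w /(_ _ e20)[s ws] vw] := h _ e20.
exists s; rewrite -(subrK w v) -addrA; apply: le_lt_trans (ler_normD _ _) _.
lra.
Qed.

Lemma closed_span_linear a v w :
  closed_span v -> closed_span w -> closed_span (a *: v + w).
Proof.
move=> Zv Zw e e0.
have e30 : 0 < e / 3 by rewrite divr_gt0.
have a10 : 0 < `|a| + 1 by rewrite ltr_wpDl.
have [t wt] := Zw _ e30.
have [s vs] := Zv _ (divr_gt0 e30 a10).
have s10 : 0 < `|rat_comb s| + 1 by rewrite ltr_wpDl.
have d0 := divr_gt0 e30 s10.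
(* Replacing [a] by [ratr q] costs at most [e / 3]; the added 1 keeps the divisor positive when the
   combination is [0]. *)
have [q] := @rat_in_itvoo R (a - e / 3 / (`|rat_comb s| + 1)) a ltac:(lra).
rewrite in_itv/= => /andP[q1 q2].
exists ([seq (q * p.1, p.2) | p <- s] ++ t).
have -> : rat_comb ([seq (q * p.1, p.2) | p <- s] ++ t) = ratr q *: rat_comb s + rat_comb t.
  rewrite /rat_comb big_cat big_map scaler_sumr; congr (_ + _).
  by apply: eq_bigr => p _; rewrite rmorphM scalerA.
have -> : a *: v + w - (ratr q *: rat_comb s + rat_comb t) =
    (a *: (v - rat_comb s) + (a - ratr q) *: rat_comb s) + (w - rat_comb t).
  by rewrite scalerBr scalerBl [X in _ = X + _]addrA subrK opprD addrACA.
apply: le_lt_trans (ler_normD _ _) _.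
have := ler_normD (a *: (v - rat_comb s)) ((a - ratr q) *: rat_comb s).
rewrite !normrZ => h.
have h1 : `|a| * `|v - rat_comb s| <= e / 3.
  rewrite ltr_pdivlMr// in vs; apply: le_trans (ltW vs).
  by rewrite mulrC ler_wpM2l// lerDl.
have h2 : `|a - ratr q| * `|rat_comb s| <= e / 3.
  rewrite -[leRHS](divfK (lt0r_neq0 s10)).
  apply: ler_pM => //; last by rewrite lerDl.
  rewrite ger0_norm; lra.
lra.
Qed.

End rat_span.

(* Eberlein-Smulian: the weak limit along an ultrafilter is a sequential weak limit, because
   countably many functionals separate the points of the closed span of the sequence, and
   that span is weakly closed. *)
Lemma reflexive_weakly_cvg_subsequence (R : realType) (E : normedModType R)
    (u : nat -> E) (C : R) :
  reflexive_space E -> (forall n, `|u n| <= C) ->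
  exists (phi : nat -> nat) (x : E), (forall k, (k <= phi k)%N) /\
    forall f, dual f -> f (u (phi k)) @[k --> \oo] --> f x.
Proof.
move=> rE uC.
(* A weak limit outside the closed span would be separated from it by a functional vanishing at
   every [u n]. *)
have span_limit (U : set_system nat) (psi : nat -> nat) x : ProperFilter U ->
    (forall f, dual f -> f (u (psi n)) @[n --> U] --> f x) -> closed_span u x.
  move=> PU ux; apply: contrapT => Zx.
  have [e e0 ex] : exists2 e : R, 0 < e & forall y, closed_span u y -> e <= `|x - y|.
    apply: contrapT => h; apply: Zx; apply: closed_span_closed => e e0.
    apply: contrapT => h'; apply: h; exists e => // y Zy.
    by rewrite leNgt; apply/negP => xy; apply: h'; exists y.
  have [f [df fZ /negP]] := separating_functional (closed_span0 u)
    (@closed_span_linear _ _ u) e0 ex.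
  apply; apply/eqP; have := ux _ df.
  rewrite (_ : (fun n => f (u (psi n))) = fun=> 0); last first.
    by apply/funext => n; rewrite fZ//; exact: closed_span_mem.
  move=> /cvg_unique; apply; [exact: Rhausdorff|exact: cvg_cst].
(* [g i] norms the rational combination of code [i]; a number coding no list stands for the empty
   combination. *)
have [g gP] := choice (fun i : nat =>
  norming_functional (rat_comb u (odflt [::] (unpickle i)))).
have [U [UU U_oo]] := ultraFilterLemma (_ : ProperFilter \oo).
have PU := @ultra_proper _ _ UU.
have [x ux] := reflexive_ultra_weak_limit rE UU uC.
have Zx : closed_span u x by exact: (span_limit U id).
(* Diagonal choice: [phi k] controls the functionals [g 0], ..., [g k] at once, up to
   [1 / (k + 1)]. *)
have /choice[phi phiP] (k : nat) : exists n, (k <= n)%N /\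
    forall i, (i <= k)%N -> `|g i x - g i (u n)| < k.+1%:R^-1.
  apply: (@filter_ex _ U); apply: filterI.
    by apply: U_oo; exact: nbhs_infty_ge.
  have : \forall n \near U, forall i : 'I_k.+1, `|g i x - g i (u n)| < k.+1%:R^-1.
    apply: filter_forall => i.
    have [dg _ _] := gP i.
    by have /cvgrPdist_lt := ux _ dg; apply; rewrite invr_gt0.
  by apply: filterS => n h i ik; exact: (h (Ordinal (ik : (i < k.+1)%N))).
exists phi, x; split=> [k|f df]; first exact: (phiP k).1.
have gphi i : g i (u (phi k)) @[k --> \oo] --> g i x.
  apply/cvgrPdist_lt => e e0; near=> k.
  apply: lt_trans ((phiP k).2 i _) _; first by near: k; exact: nbhs_infty_ge.
  by near: k; exact: near_infty_natSinv_lt (PosNum e0).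
apply: contrapT => nfx.
have [e e0 fe] : exists2 e : R, 0 < e & ~ (\forall k \near \oo, `|f x - f (u (phi k))| < e).
  apply: contrapT => h; apply: nfx; apply/cvgrPdist_lt => e e0.
  by apply: contrapT => h'; apply: h; exists e.
(* An ultrafilter [V] refining [F] yields a second weak limit [x'], on which [f] stays away from
   [f x]; it remains to show [x' = x]. *)
pose F := within (~` [set k | `|f x - f (u (phi k))| < e]) \oo.
have PF : ProperFilter F.
  split; last exact: within_filter.
  by rewrite /F /within /= => h; apply: fe; apply: filterS h => k /= h; exact: contrapT.
have [V [UV FV]] := ultraFilterLemma PF.
have PV := @ultra_proper _ _ UV.
have [x' ux'] := reflexive_ultra_weak_limit rE UV (fun k => uC (phi k)).
have Zx' : closed_span u x' by exact: (span_limit V phi).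
have V_oo : \oo `<=` V by apply: subset_trans FV; exact: cvg_within.
have gx i : g i x' = g i x.
  have [dg _ _] := gP i.
  apply: (@cvg_unique _ _ (g i (u (phi n)) @[n --> V])); first exact: Rhausdorff.
  - exact: ux'.
  - by apply: cvg_trans (gphi i); exact: cvg_app.
have xx' : x' = x.
  apply/eqP; rewrite -subr_eq0 -normr_le0 leNgt; apply/negP => z0.
  have Zz : closed_span u (x' - x).
    by rewrite addrC -scaleN1r; exact: closed_span_linear.
  (* A combination within a third of [|x' - x|] of [x' - x] is normed by some [g i], which vanishes
     at [x' - x]; so its own norm is below that third, a contradiction. *)
  have [s zs] := Zz _ (divr_gt0 z0 (ltr0n R 3)).
  have [dg gn gs] := gP (pickle s).
  have := gn ((x' - x) - rat_comb u s).
  rewrite !(dualB _ _ dg) gx subrr sub0r normrN.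
  rewrite pickleK /= in gs; rewrite gs normr_id.
  have := ler_normD (x' - x - rat_comb u s) (rat_comb u s); rewrite subrK.
  lra.
have : V (~` [set k | `|f x - f (u (phi k))| < e]).
  by apply: FV; exact: withinT.
have : V [set k | `|f x' - f (u (phi k))| < e].
  by have /cvgrPdist_lt := ux' _ df; apply.
rewrite xx' => h1 h2; have : V set0.
  by rewrite -(setICr [set k | `|f x - f (u (phi k))| < e]); exact: filterI.
exact: filter_not_empty.
Unshelve. all: by end_near. Qed.

(** * Calculus along lines *)

Section C1.
Variables (R : realType) (E : normedModType R) (f : E -> R^o).
Implicit Types (x v w : E) (s t : R).
Hypothesis f_C1 : class_C1 f.

Lemma dual_diff x : dual ('d f x : E -> R^o).
Proof.
split; first exact: linearP.
by apply: diff_continuous; exact: (f_C1.1 x).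
Qed.

Lemma is_derive_line x v (s : R) :
  is_derive s 1 (fun s : R => f (x + s *: v)) ('d f (x + s *: v) v).
Proof.
pose l (s : R^o) : E := x + s *: v.
have dl : is_diff s l ( *:%R ^~ v).
  have : is_diff s (cst x + ( *:%R ^~ v : R^o -> E)) (0 + *:%R ^~ v) by exact: is_diffD.
  by rewrite add0r.
have dsl : differentiable l s by exact: ex_diff.
have df : differentiable f (l s) := f_C1.1 _.
have dfl : differentiable (f \o l) s by exact: differentiable_comp.
apply: DeriveDef; first exact/derivable1_diffP.
rewrite deriveE// (diff_comp dsl df)//.
by rewrite /= diff_val scale1r.
Qed.

Lemma continuous_C1 : continuous f.
Proof. by move=> x; apply: differentiable_continuous; exact: f_C1.1. Qed.

Lemma continuous_line x v : continuous (fun s : R => f (x + s *: v)).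
Proof.
move=> s; apply: differentiable_continuous; apply/derivable1_diffP.
exact: (@ex_derive _ _ _ _ _ _ _ (is_derive_line x v s)).
Qed.

Lemma MVT_line x v (a b : R) : a < b ->
  exists2 c, a < c < b & f (x + b *: v) - f (x + a *: v) = 'd f (x + c *: v) v * (b - a).
Proof.
move=> ab.
have [||c cab ->] := @MVT R (fun s : R => f (x + s *: v)) (fun s => 'd f (x + s *: v) v) a b ab.
- by move=> s _; exact: is_derive_line.
- exact/continuous_subspaceT/continuous_line.
by exists c => //; rewrite in_itv/= in cab.
Qed.

(** Joint continuity of the derivative in base point and direction: the change of base point is
    small in dual norm and acts on bounded directions. *)
Lemma cvg_diff (T : Type) (F : set_system T) {FF : Filter F} (g h : T -> E) (x w : E) :
  g t @[t --> F] --> x -> h t @[t --> F] --> w -> 'd f (g t) (h t) @[t --> F] --> 'd f x w.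
Proof.
move=> gx hw; apply/cvgrPdist_lt => e e0.
have w1 : 0 < `|w| + 1 by rewrite ltr_wpDl.
have ew0 : 0 < e / 2 / (`|w| + 1) by rewrite !divr_gt0.
have d1 : \forall t \near F, dual_norm (fun v => 'd f (g t) v - 'd f x v) < e / 2 / (`|w| + 1).
  have /cvgrPdist_lt/(_ _ ew0) := cvg_comp _ _ gx (f_C1.2 x).
  by apply: filterS => t /=; rewrite sub0r normrN; apply: le_lt_trans; exact: ler_norm.
have [_ cx] := dual_diff x.
have d2 : \forall t \near F, `|'d f x w - 'd f x (h t)| < e / 2.
  have := cvg_comp _ _ hw (cx w); move/cvgrPdist_lt; apply; rewrite divr_gt0//.
have d3 : \forall t \near F, `|h t| < `|w| + 1.
  have : \forall t \near F, `|w - h t| < 1 by have /cvgrPdist_lt := hw; apply.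
  apply: filterS => t; have := ler_normD (h t - w) w; rewrite subrK distrC; lra.
near=> t.
have a1 : dual_norm (fun v => 'd f (g t) v - 'd f x v) < e / 2 / (`|w| + 1) by near: t.
have a2 : `|'d f x w - 'd f x (h t)| < e / 2 by near: t.
have a3 : `|h t| < `|w| + 1 by near: t.
have dd : dual (fun v => 'd f (g t) v - 'd f x v : R^o).
  split.
    move=> a u v; rewrite (dual_linear (dual_diff (g t))) (dual_linear (dual_diff x)).
    by rewrite /GRing.scale /=; lra.
  move=> v; apply: cvgB; [exact: (dual_diff (g t)).2|exact: (dual_diff x).2].
have := dual_norm_ge (h t) dd => /= a4.
have a5 : dual_norm (fun v => 'd f (g t) v - 'd f x v) * `|h t| <= e / 2.
  rewrite -[leRHS](divfK (lt0r_neq0 w1)); apply: ler_pM => //; try exact: ltW.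
  exact: dual_norm_ge0.
have -> : 'd f x w - 'd f (g t) (h t) =
  ('d f x w - 'd f x (h t)) - ('d f (g t) (h t) - 'd f x (h t)) by lra.
apply: le_lt_trans (ler_normB _ _) _; lra.
Unshelve. all: by end_near. Qed.

End C1.

(** * The Nehari set *)

Section nehari.
Variables (R : realType) (E : normedModType R) (f : E -> R^o).
Implicit Types (x v w : E) (s t : R).
Hypothesis f_C1 : class_C1 f.
Hypothesis f_monotone : forall x, x != 0 -> forall s t : R, 0 < s -> s <= t ->
  'd f (t *: x) x / t <= 'd f (s *: x) x / s.
Hypothesis f0 : f 0 = 0.
Variables r m : R.
Hypotheses (r_gt0 : 0 < r) (m_gt0 : 0 < m).
Hypothesis f_sphere : forall x : E, `|x| = r -> m <= f x.
Hypothesis f_ray : forall x : E, x != 0 -> exists2 M : R, 0 < M &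
  forall s, M <= s -> (f (s *: x) : R) <= 0.

Lemma MVT_ray x (a b : R) : a < b ->
  exists2 c, a < c < b & f (b *: x) - f (a *: x) = 'd f (c *: x) x * (b - a).
Proof.
move=> ab; have [c cab h] := MVT_line f_C1 0 x ab.
by exists c => //; move: h; rewrite !add0r.
Qed.

Lemma continuous_ray (x : E) : continuous (fun s : R => f (s *: x)).
Proof.
rewrite (_ : (fun s : R => f (s *: x)) = fun s : R => f (0 + s *: x)).
  exact: continuous_line.
by apply/funext => s; rewrite add0r.
Qed.

(** The quotient in [f_monotone] vanishes at parameter 1, so [f] does not decrease along the ray
    before 1 and does not increase after it. *)
Lemma nehari_ray_max x : nehari f x -> forall s, 0 <= s -> f (s *: x) <= f x.
Proof.
move=> [x0 dx] s s0; have dx1 : 'd f (1 *: x) x / 1 = 0 by rewrite scale1r dx mul0r.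
rewrite -[x in leRHS]scale1r -subr_ge0.
have [s1|s1|<-] := ltgtP s 1; last by rewrite subrr.
- have [c /andP[sc c1] ->] := MVT_ray x s1.
  have c0 : 0 < c := le_lt_trans s0 sc.
  have := f_monotone x0 c0 (ltW c1).
  rewrite dx1 pmulr_lge0 ?invr_gt0// => h.
  by rewrite mulr_ge0// subr_ge0 ltW.
- rewrite -opprB oppr_ge0.
  have [c /andP[c1 cs] ->] := MVT_ray x s1.
  have c0 : 0 < c := lt_trans ltr01 c1.
  have := f_monotone x0 ltr01 (ltW c1).
  rewrite dx1 pmulr_lle0 ?invr_gt0// => h.
  by rewrite mulr_le0_ge0// subr_ge0 ltW.
Qed.

Lemma nehari_ray_maximum x s : 0 < s -> nehari f (s *: x) ->
  maximums (ray_values f x) (f (s *: x)).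
Proof.
move=> s0 Ns; split; first by exists s => //; exact: ltW.
move=> _ [t /= t0 <-].
have := nehari_ray_max Ns (divr_ge0 t0 (ltW s0)).
by rewrite scalerA divfK// gt_eqF.
Qed.

Lemma f_radial x : x != 0 -> m <= f ((r / `|x|) *: x).
Proof.
move=> x0; apply: f_sphere.
by rewrite normrZ normrM normfV normr_id divfK ?normr_eq0// gtr0_norm.
Qed.

Lemma nehari_level x : nehari f x -> m <= f x.
Proof.
move=> Nx; apply: le_trans (f_radial Nx.1) (nehari_ray_max Nx _).
by rewrite divr_ge0// ltW.
Qed.

(** On [[0, M]] the ray reaches level [m > 0] but is at most [0] at both ends, so its maximum is
    interior and the radial derivative vanishes there. *)
Lemma nehari_exists x : x != 0 -> exists2 s : R, 0 < s & nehari f (s *: x).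
Proof.
move=> x0; have [M M0 fM] := f_ray x0.
have [|c] := EVT_max (ltW M0) (_ : {within `[0, M], continuous (fun s : R => f (s *: x))}).
  exact/continuous_subspaceT/continuous_ray.
rewrite in_itv/= => /andP[c0 cM] cmax.
have fc : m <= f (c *: x).
  apply: le_trans (f_radial x0) (cmax _ _).
  rewrite in_itv/= divr_ge0 ?(ltW r_gt0)//= leNgt; apply/negP => /ltW /fM.
  by move=> /(le_trans (f_radial x0)); rewrite leNgt m_gt0.
have {}c0 : 0 < c.
  rewrite lt_neqAle c0 andbT; apply/eqP => c0'.
  by move: fc; rewrite -c0' scale0r f0 leNgt m_gt0.
have {}cM : c < M.
  rewrite lt_neqAle cM andbT; apply/eqP => c0'.
  by have := le_trans fc (fM _ _); rewrite c0' lexx leNgt m_gt0 => /(_ isT).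
have drv (s : R^o) : is_derive s 1 (fun s : R => f (s *: x)) ('d f (s *: x) x).
  have := is_derive_line f_C1 0 x s; rewrite add0r.
  by rewrite (_ : (fun s : R => f (0 + s *: x)) = fun s => f (s *: x))//;
    apply/funext => t; rewrite add0r.
have := @derive1_at_max _ (fun s : R => f (s *: x)) 0 M c (ltW M0).
move=> /(_ (fun t _ => @ex_derive _ _ _ _ _ _ _ (drv t))).
rewrite in_itv/= c0 cM => /(_ isT) => h.
have {}h : is_derive c 1 (fun s : R => f (s *: x)) 0.
  by apply: h => t; rewrite in_itv/= => /andP[t0 tM]; apply: cmax; rewrite in_itv/= !ltW.
have dc : 'd f (c *: x) x = 0.
  by rewrite -(@derive_val _ _ _ _ _ _ _ (drv c)); exact: derive_val.
exists c => //; split; first by rewrite scaler_eq0 negb_or gt_eqF.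
by rewrite linearZ /= dc scaler0.
Qed.

(** The mean value theorem on [[0, 1]] and [[1, M]]. Monotonicity alone gives only weak signs;
    strict ones survive a small perturbation of the ray. *)
Lemma nehari_crossing x : nehari f x -> exists a b : R,
  [/\ 0 < a, a < b, 0 < 'd f (a *: x) x & 'd f (b *: x) x < 0].
Proof.
move=> Nx; have fx := nehari_level Nx.
have [M M0 fM] := f_ray Nx.1.
have M1 : 1 < M.
  rewrite ltNge; apply/negP => /fM; rewrite scale1r => /(le_trans fx).
  by rewrite leNgt m_gt0.
have [a /andP[a0 a1]] := MVT_ray x ltr01.
rewrite scale1r scale0r f0 !subr0 mulr1 => da.
have [b /andP[b1 bM]] := MVT_ray x M1.
rewrite scale1r => db; exists a, b; split => //.
- exact: lt_trans a1 b1.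
- by rewrite -da; exact: lt_le_trans fx.
- have M10 : 0 < M - 1 by lra.
  rewrite -(pmulr_llt0 _ M10) -db subr_lt0.
  exact: le_lt_trans (fM _ (lexx M)) (lt_le_trans m_gt0 fx).
Qed.

(** A descent vector at one parameter remains one nearby. The parameters at level [f x] form a
    compact set, so finitely many such vectors suffice, glued by bump functions. *)
Lemma descent_field x (a b : R) :
  (forall s, a <= s <= b -> f (s *: x) = f x -> exists v, 'd f (s *: x) v != 0) ->
  exists2 V : R -> E, continuous V &
    forall s, a <= s <= b -> f (s *: x) = f x -> 'd f (s *: x) (V s) < 0.
Proof.
move=> noncrit.
pose S := `[a, b] `&` [set s : R | f (s *: x) = f x].
have cS : compact S.
  apply: (subclosed_compact _ (@segment_compact _ a b)); last exact: subIsetl.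
  apply: closedI; first exact: interval_closed.
  apply: (@preimage_closed _ _ (fun s : R => f (s *: x)) [set f x]).
    by move=> s _; exact: continuous_ray.
  exact: closed_eq.
have /choice[w wP] (s : R) : exists p : E * R, S s ->
    0 < p.2 /\ forall t, `|s - t| < p.2 -> 'd f (t *: x) p.1 < 0.
  have [[sab fs]|nS] := pselect (S s); last by exists (0, 0).
  have [v dv] : exists v, 'd f (s *: x) v < 0.
    have [|v] := noncrit s _ fs; first by rewrite /= in_itv in sab.
    by rewrite neq_lt => /orP[v0|v0]; [exists v|exists (- v); rewrite linearN oppr_lt0].
  have cv : 'd f (t *: x) v @[t --> s] --> 'd f (s *: x) v.
    by apply: (cvg_diff f_C1); [exact: scalel_continuous|exact: cvg_cst].
  have /nbhs_ballP[d /= d0 dP] : \forall t \near s, 'd f (t *: x) v < 0.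
    exact: cvgr_lt cv _ dv.
  by exists (v, d).
have := cS; rewrite compact_cover => /(_ R S (fun s => ball s (w s).2)).
case=> [s _|s Ss|D DS cover]; first exact: ball_open.
  by exists s => //; apply: ballxx; exact: (wP s Ss).1.
have SD i : i \in D -> S i by move=> /DS /set_mem.
(* Each bump is supported where its vector is a descent direction, so no summand is positive. *)
exists (fun s => \sum_(i <- D) Num.max 0 ((w i).2 - `|i - s|) *: (w i).1).
  apply: continuous_big => [|i _ s]; first exact: add_continuous.
  apply: cvgZr_tmp.
  apply: (@continuous_max _ _ (cst 0) (fun s : R => (w i).2 - `|i - s|) s).
    exact: cvg_cst.
  apply: cvgB; first exact: cvg_cst.
  by apply: cvg_norm; apply: cvgB; [exact: cvg_cst|exact: cvg_id].
move=> s sab fs; rewrite linear_sum /=.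
have term_le0 i : i \in D ->
    'd f (s *: x) (Num.max 0 ((w i).2 - `|i - s|) *: (w i).1) <= 0.
  move=> /SD /wP[_ wi]; rewrite linearZ /=.
  have [_|si] := leP ((w i).2 - `|i - s|) 0; first by rewrite scale0r.
  by rewrite mulr_ge0_le0// ltW// wi// -subr_gt0.
have [|i iD si] := cover s; first by split=> //=; rewrite in_itv.
rewrite (big_rem i)//=.
have [_ wi] := wP i (SD i iD).
rewrite -ball_normE /= in si.
apply: ltr_wnDr.
  by rewrite big_seq sumr_le0// => j /mem_rem; exact: term_le0.
rewrite linearZ /= max_r; last by rewrite subr_ge0 ltW.
by rewrite pmulr_rlt0 ?subr_gt0//; exact: wi.
Qed.

(** The perturbed rays meet the Nehari set at parameters in [[a, b]]. A cluster point [s0] of these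
    parameters as [t] tends to [0] reduces the level estimate to a neighbourhood of [(0, s0)]. *)
Lemma nehari_minimizer_critical x : nehari f x ->
  (forall y, nehari f y -> f x <= f y) ->
  exists s, f (s *: x) = f x /\ critical_point f (s *: x).
Proof.
move=> Nx xmin; apply: contrapT => noncrit.
have [a [b [a0 ab da db]]] := nehari_crossing Nx.
have [|V cV dV] := @descent_field x a b.
  move=> s _ fs; apply: contrapT => h; apply: noncrit; exists s; split=> // v.
  by apply: contrapT => /eqP dv; apply: h; exists v.
pose H (t s : R) : E := s *: x + t *: V s.
have cVs (p : R * R) : V q.2 @[q --> p] --> V p.2.
  by apply: (@cvg_comp _ _ _ snd V); [exact: cvg_snd|exact: cV].
have cH (p : R * R) : H q.1 q.2 @[q --> p] --> H p.1 p.2.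
  apply: cvgD.
    by apply: cvgZ; [exact: cvg_snd|exact: cvg_cst].
  apply: cvgZ; first exact: cvg_fst.
  exact: cVs.
have cHs t : continuous (H t).
  move=> s.
  apply: (@cvg_comp _ _ _ (fun s : R => (t, s)) (fun q : R * R => H q.1 q.2) _ (nbhs (t, s))).
    apply: (@cvg_pair _ _ _ (nbhs s) (nbhs t) (nbhs s) _ _ _ (cst t) id); first exact: cvg_cst.
    exact: cvg_id.
  by have := cH (t, s).
have cH0 s : H t s @[t --> 0^'+] --> s *: x.
  have -> : s *: x = H 0 s by rewrite /H scale0r addr0.
  apply: (@cvg_comp _ _ _ (fun t : R => (t, s)) (fun q : R * R => H q.1 q.2) _ (nbhs ((0 : R), s))).
    apply: (@cvg_pair _ _ _ 0^'+ (nbhs 0) (nbhs s) _ _ _ id (cst s)); last exact: cvg_cst.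
    by apply: cvg_at_right_filter; exact: cvg_id.
  by have := cH (0, s).
pose psi (t s : R) := 'd f (H t s) (H t s) : R.
have cpsi t : continuous (psi t) by move=> s; apply: cvg_diff => //; exact: cHs.
have cpsi0 s : psi t s @[t --> 0^'+] --> 'd f (s *: x) (s *: x).
  by apply: cvg_diff => //; exact: cH0.
have crossing : \forall t \near 0^'+, exists s, a <= s <= b /\ psi t s = 0.
  have psia : \forall t \near 0^'+, 0 < psi t a.
    by apply: (cvgr_gt _ (cpsi0 a)); rewrite linearZ mulr_gt0.
  have psib : \forall t \near 0^'+, psi t b < 0.
    apply: (cvgr_lt _ (cpsi0 b)); rewrite linearZ pmulr_rlt0//.
    exact: lt_trans a0 ab.
  near=> t.
  have pa : 0 < psi t a by near: t.
  have pb : psi t b < 0 by near: t.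
  have [||s sab ps] := @IVT R (psi t) a b 0 (ltW ab).
  - exact/continuous_subspaceT/cpsi.
  - by rewrite ge_min le_max (ltW pa) (ltW pb) orbT.
  by exists s; rewrite in_itv in sab.
(* [sg t] is a crossing parameter whenever there is one; the default [0] only occurs otherwise. *)
have /choice[sg sgP] (t : R) : exists s, (exists s, a <= s <= b /\ psi t s = 0) ->
    a <= s <= b /\ psi t s = 0.
  by have [[s h]|h] := pselect (exists s, a <= s <= b /\ psi t s = 0); [exists s|exists 0].
have [|s0 [sab0 clus]] := @segment_compact _ a b (sg @ 0^'+) _.
  by apply: filterS crossing => t /sgP[]; rewrite /= in_itv.
rewrite /= in_itv/= in sab0.
have nz : \forall p \near (0 : R, s0), H p.1 p.2 != 0.
  have cH' := cH (0, s0); rewrite /= {2}/H scale0r addr0 in cH'.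
  apply: (cvgr_neq0 _ cH').
  by rewrite scaler_eq0 negb_or Nx.1 andbT gt_eqF//; case/andP: sab0 => /(lt_le_trans a0).
(* If [s0 *: x] lies strictly below the level [f x], so do all nearby points; otherwise [V] is a
   descent direction nearby. *)
have good : (\forall p \near (0 : R, s0), f (H p.1 p.2) < f x) \/
    (\forall p \near (0 : R, s0), 'd f (H p.1 p.2) (V p.2) < 0).
  have H0 : H 0 s0 = s0 *: x by rewrite /H scale0r addr0.
  have cH' := cH (0, s0); rewrite /= H0 in cH'.
  have [fs0|fs0] := eqVneq (f (s0 *: x)) (f x).
    right.
    have cdV : 'd f (H p.1 p.2) (V p.2) @[p --> (0 : R, s0)] --> 'd f (s0 *: x) (V s0).
      by apply: cvg_diff => //; exact: (cVs (0, s0)).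
    by apply: (cvgr_lt _ cdV); exact: dV.
  left; have cfH : f (H p.1 p.2) @[p --> (0 : R, s0)] --> f (s0 *: x).
    by apply: (@cvg_comp _ _ _ (fun p : R * R => H p.1 p.2) f _ _ _ cH'); exact: continuous_C1.
  apply: (cvgr_lt _ cfH).
  rewrite lt_neqAle fs0 nehari_ray_max//.
  by case/andP: sab0 => /(lt_le_trans a0)/ltW.
(* The property is obtained at a crossing [(t, s)] and on the whole segment down to [(0, s)], as the
   mean value theorem in [t] demands. *)
have pick (P : R * R -> Prop) : (\forall p \near (0 : R, s0), P p) ->
    exists t s, [/\ 0 < t, 0 <= s, psi t s = 0 & forall u, 0 <= u <= t -> P (u, s)].
  move=> /nbhs_ballP[d /= d0 dP].
  have small : \forall t \near 0^'+, 0 < t < d.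
    by near=> t; apply/andP; split; near: t; [exact: nbhs_right_gt|exact: nbhs_right_lt].
  have FA : \forall t \near 0^'+,
      [set s | exists t, [/\ 0 < t, t < d, 0 <= s & psi t s = 0]] (sg t).
    near=> t; have [|/andP[at_ _] pt] := sgP t; first by near: t.
    have /andP[t0 td] : 0 < t < d by near: t.
    by exists t; split=> //; exact: le_trans (ltW a0) at_.
  have [s [[t [t0 td s_ge0 pts]] s0s]] := clus _ _ FA (nbhsx_ballx s0 d d0).
  exists t, s; split=> // u /andP[u0 ut]; apply: dP; split=> //=.
  by rewrite -ball_normE /= sub0r normrN ger0_norm//; exact: le_lt_trans td.
have min_le t s : H t s != 0 -> psi t s = 0 -> f x <= f (H t s).
  by move=> h p; apply: xmin.
case: good => [low|neg].
  have [t [s [t0 _ ps /(_ t)]]] := pick _ (filterI nz low).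
  rewrite lexx (ltW t0) => /(_ isT)[/= /min_le /(_ ps)].
  by rewrite leNgt => /negP.
have [t [s [t0 s_ge0 ps tP]]] := pick _ (filterI nz neg).
(* Descent gives [f (H t s) < f (s *: x) <= f x], against the minimality of [f x]. *)
have [c /andP[c0 ct] fE] := MVT_line f_C1 (s *: x) (V s) t0.
have [/= _ dc] := tP c ltac:(by rewrite !ltW).
have [/= nH _] := tP t ltac:(by rewrite lexx ltW).
have := le_trans (nehari_ray_max Nx s_ge0) (min_le _ _ nH ps).
rewrite scale0r addr0 subr0 in fE; rewrite -subr_ge0 fE.
by rewrite pmulr_lge0// leNgt dc.
Unshelve. all: by end_near. Qed.

End nehari.

(** * Energy functionals *)

Section energy.
Variables (R : realType) (E : normedModType R) (I : E -> R^o).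
Implicit Types (x v e : E) (s t : R).
Hypothesis I_C1 : class_C1 I.
Hypothesis energy_C1 : class_C1 (energy I).
Hypothesis I_at0 : I x / `|x| ^+ 2 @[x --> (0 : E)^'] --> (0 : R).

Lemma energy_ray s x : energy I (s *: x) = 2^-1 * s ^+ 2 * `|x| ^+ 2 - I (s *: x) :> R.
Proof.
by rewrite /energy normrZ exprMn real_normK ?num_real// mulrA.
Qed.

(** Only the restriction of the norm to a ray is differentiated; its square is there a quadratic
    polynomial. *)
Lemma diff_energy_ray s x : 'd (energy I) (s *: x) x = s * `|x| ^+ 2 - 'd I (s *: x) x :> R.
Proof.
have d1 := is_derive_line energy_C1 0 x s.
have d2 := is_derive_line I_C1 0 x s.
rewrite !add0r in d1 d2.
have d3 : is_derive s 1
    ((fun t : R^o => (2^-1 * `|x| ^+ 2) *: t ^+ 2 : R^o) - (fun t => I (0 + t *: x)))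
    ((2^-1 * `|x| ^+ 2) *: (2%:R * s ^+ 1 *: 1) - 'd I (s *: x) x).
  apply: is_deriveB; apply: is_deriveZ; exact: (@is_deriveX R R^o id 2).
have fE : (fun t : R^o => (2^-1 * `|x| ^+ 2) *: t ^+ 2 : R^o) - (fun t => I (0 + t *: x)) =
    (fun t => energy I (0 + t *: x)).
  apply/funext => t; rewrite add0r energy_ray -[in RHS](add0r (t *: x)).
  by congr (_ - _); rewrite /GRing.scale /=; ring.
rewrite fE in d3.
have := @derive_val _ _ _ _ _ _ _ d1; rewrite (@derive_val _ _ _ _ _ _ _ d3) => <-.
by rewrite /GRing.scale /=; field.
Qed.

Lemma energy_near0 : exists r : R,
  0 < r /\ forall x, `|x| < r -> x != 0 -> `|I x| <= `|x| ^+ 2 / 4.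
Proof.
have /cvgrPdist_lt/(_ 4^-1 ltac:(by rewrite invr_gt0)) := I_at0.
rewrite near_withinE => /nbhs_ballP[r /= r0 rI].
exists r; split=> // x xr x0.
have := rI x; rewrite -ball_normE /= sub0r normrN => /(_ xr x0).
rewrite sub0r normrN normrM normfV [X in _ / X]ger0_norm ?exprn_ge0//.
rewrite ltr_pdivrMr ?exprn_gt0 ?normr_gt0// => /ltW; rewrite mulrC //.
Qed.

(** The limit in [I_at0] only sees nonzero points, so the value at [0] is reached by continuity
    along the ray of a nonzero vector. *)
Lemma I0_eq0 : (exists x : E, x != 0) -> I 0 = 0.
Proof.
move=> [e e0]; have [r [r0 rI]] := energy_near0.
have ce : t *: e @[t --> (0 : R)^'+] --> (0 : E).
  rewrite -(scale0r e); apply: cvgZr_tmp; apply: cvg_at_right_filter; exact: cvg_id.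
have c1 : I (t *: e) @[t --> (0 : R)^'+] --> I 0.
  by apply: (@cvg_comp _ _ _ (fun t => t *: e) I _ _ _ ce); exact: continuous_C1.
have c2 : `|t *: e| ^+ 2 / 4 @[t --> (0 : R)^'+] --> `|0 : E| ^+ 2 / 4.
  apply: cvgMr_tmp; rewrite expr2; under eq_fun do rewrite expr2.
  by apply: cvgM; exact: (cvg_norm ce).
rewrite normr0 expr0n mul0r in c2.
have small : \forall t \near (0 : R)^'+, `|I (t *: e)| <= `|t *: e| ^+ 2 / 4.
  have n1 : \forall t \near (0 : R)^'+, `|t *: e| < r.
    by apply: (cvgr_norm_lt _ ce); rewrite normr0.
  near=> t; apply: rI; first by near: t.
  by rewrite scaler_eq0 negb_or e0 andbT gt_eqF//; near: t; exact: nbhs_right_gt.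
have c3 : I (t *: e) @[t --> (0 : R)^'+] --> (0 : R).
  apply: norm_cvg0; apply: squeeze_cvgr (cvg_cst 0) c2.
  by apply: filterS small => t ->; rewrite normr_ge0.
by apply: (cvg_unique _ c1 c3); exact: Rhausdorff.
Unshelve. all: by end_near. Qed.

Lemma energy_monotone :
  (forall x, x != 0 -> forall s t, 0 < s -> s <= t ->
     'd I (s *: x) x / s <= 'd I (t *: x) x / t) ->
  forall x, x != 0 -> forall s t, 0 < s -> s <= t ->
    'd (energy I) (t *: x) x / t <= 'd (energy I) (s *: x) x / s.
Proof.
move=> mono x x0 s t s0 st; have t0 : 0 < t := lt_le_trans s0 st.
rewrite !diff_energy_ray !mulrBl mulrAC divff ?gt_eqF// mulrAC divff ?gt_eqF//.
by rewrite lerD2l lerN2; exact: mono.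
Qed.

Lemma energy_sphere : exists r m : R, [/\ 0 < r, 0 < m &
  forall x, `|x| = r -> m <= energy I x].
Proof.
have [r [r0 rI]] := energy_near0.
(* Radius [r / 2] is inside the ball of [energy_near0], and [1/2 - 1/4 = 1/4]. *)
exists (r / 2), ((r / 2) ^+ 2 / 4); split; rewrite ?divr_gt0 ?exprn_gt0 ?divr_gt0//.
move=> x xr; have := rI x; rewrite -normr_eq0 xr => /(_ ltac:(lra) ltac:(rewrite gt_eqF//; lra)).
rewrite ler_norml => /andP[_]; rewrite /energy xr; lra.
Qed.

Lemma energy_ray_nonpositive :
  (forall K : set E, weakly_compact K -> K `<=` [set~ 0] ->
     forall A : R, \forall s \near +oo,
       forall x, K x -> A <= I (s *: x) / s ^+ 2) ->
  forall x, x != 0 -> exists2 M : R, 0 < M &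
    forall s, M <= s -> (energy I (s *: x) : R) <= 0.
Proof.
move=> superquad x x0.
(* A singleton is weakly compact, and the bound [|x| ^+ 2] exceeds the quadratic coefficient
   [|x| ^+ 2 / 2]. *)
have [||M [_ MI]] := superquad [set x] _ _ (`|x| ^+ 2).
- exact: (@compact_set1 (weak E)).
- by move=> y -> /=; exact/eqP.
exists (Num.max 0 M + 1); first by rewrite ltr_wpDl// le_max lexx.
move=> s Ms.
have sM : M < s by move: Ms; rewrite -lerBrDr ge_max => /andP[_]; lra.
have s0 : 0 < s by move: Ms; rewrite -lerBrDr ge_max => /andP[]; lra.
have := MI s sM x erefl; rewrite ler_pdivlMr ?exprn_gt0// energy_ray.
have : 0 <= `|x| ^+ 2 * s ^+ 2 by rewrite mulr_ge0// exprn_ge0// ltW.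
lra.
Qed.

(* The energy is bounded along the whole ray of each [u n], so the minimizing sequence of the
   Nehari set need not be bounded: its normalization has a weak limit anyway. *)
Lemma energy_weak_limit (u : nat -> E) (phi : nat -> nat) e (c : nat -> R) (l : R) :
  weakly_seq_continuous I ->
  (forall n, `|u n| = 1) -> (forall n s, 0 <= s -> energy I (s *: u n) <= c n) ->
  c @ \oo --> l -> (forall k, (k <= phi k)%N) ->
  (forall g, dual g -> g (u (phi k)) @[k --> \oo] --> g e) ->
  forall s, 0 <= s -> 2^-1 * s ^+ 2 - I (s *: e) <= l.
Proof.
move=> Iw u1 uc cl phi_ge ue s s0.
have cphi : c (phi k) @[k --> \oo] --> l.
  apply: (@cvg_comp _ _ _ phi c _ \oo _ _ cl).
  move=> A [N _ NA]; exists N => // k /= Nk; apply: NA => /=.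
  exact: leq_trans Nk (phi_ge k).
have Ie : I (s *: u (phi k)) @[k --> \oo] --> I (s *: e).
  apply: Iw; apply: weakly_cvgP => g dg.
  under eq_fun do rewrite (dualZ _ _ dg).
  by rewrite (dualZ _ _ dg); apply: cvgMl_tmp; exact: ue.
have fe : 2^-1 * s ^+ 2 - I (s *: u (phi k)) @[k --> \oo] --> 2^-1 * s ^+ 2 - I (s *: e).
  by apply: cvgB => //; exact: cvg_cst.
apply: (ler_cvg_to fe cphi).
apply: nearW => k; have := uc (phi k) s s0.
by rewrite energy_ray u1 expr1n mulr1.
Qed.

Lemma energy_nehari_minimizer :
  (exists x : E, x != 0) -> reflexive_space E -> weakly_seq_continuous I ->
  (forall K : set E, weakly_compact K -> K `<=` [set~ 0] ->
     forall A : R, \forall s \near +oo,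
       forall x, K x -> A <= I (s *: x) / s ^+ 2) ->
  (forall x, x != 0 -> forall s t, 0 < s -> s <= t ->
     'd I (s *: x) x / s <= 'd I (t *: x) x / t) ->
  exists2 x, nehari (energy I) x & forall y, nehari (energy I) y -> (energy I x : R) <= energy I y.
Proof.
move=> nz rE Iw /energy_ray_nonpositive ray_le0 /energy_monotone mono.
have I0 := I0_eq0 nz.
have f0 : energy I 0 = 0 by rewrite /energy I0 normr0 expr0n mulr0 subr0.
have [r [m [r0 m0 sphere]]] := energy_sphere.
have ray_max := nehari_ray_max energy_C1 mono.
have exN := nehari_exists energy_C1 f0 r0 m0 sphere ray_le0.
pose L : set R := [set energy I x | x in nehari (energy I)].
have L_lb : has_lbound L.
  by exists m => _ [x Nx <-]; exact: (nehari_level energy_C1 mono r0 sphere Nx).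
have L_inf : has_inf L.
  by split=> //; have [e /exN[s _ Ns]] := nz; exists (energy I (s *: e)), (s *: e).
have /choice[xs xsP] (n : nat) : exists x,
    nehari (energy I) x /\ (energy I x : R) <= inf L + n.+1%:R^-1.
  have [|_ [x Nx <-] h] := @inf_adherent _ L n.+1%:R^-1 _ L_inf; first by rewrite invr_gt0.
  by exists x; split=> //; exact: ltW.
have xs0 n : 0 < `|xs n| by rewrite normr_gt0; exact: (xsP n).1.1.
pose u n := `|xs n|^-1 *: xs n.
have u1 n : `|u n| = 1 by rewrite normrZ normfV normr_id mulVf// gt_eqF.
have [n|phi [e [phi_ge ue]]] := @reflexive_weakly_cvg_subsequence _ _ u 1 rE.
  by rewrite u1.
have cl : (inf L + n.+1%:R^-1) @[n --> \oo] --> inf L.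
  rewrite -[X in _ --> X]addr0; apply: cvgD; [exact: cvg_cst|exact: cvg_harmonic].
(* [u n] spans the ray of the Nehari point [xs n], whose energy is the maximum on it. *)
have lim_le : forall s, 0 <= s -> 2^-1 * s ^+ 2 - I (s *: e) <= inf L.
  apply: (energy_weak_limit Iw u1 _ cl phi_ge ue) => n s s0.
  apply: le_trans (xsP n).2; rewrite /u scalerA.
  by apply: ray_max; [exact: (xsP n).1|rewrite divr_ge0].
(* For [e = 0] the bound reads [s ^+ 2 / 2 <= inf L], which fails at [s = inf L + 2]. *)
have e0 : e != 0.
  apply/eqP => e0; have mL : 0 <= inf L.
    apply: lb_le_inf L_inf.1 _ => _ [x Nx <-]; apply: ltW; apply: lt_le_trans m0 _.
    exact: (nehari_level energy_C1 mono r0 sphere Nx).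
  have := lim_le (inf L + 2) ltac:(lra); rewrite e0 scaler0 I0 subr0.
  nra.
(* Weak lower semicontinuity of the norm, by a functional norming [e]. With it [energy I (s *: e)]
   is at most the left side of [lim_le]. *)
have e1 : `|e| <= 1.
  have [g [dg gn ge]] := norming_functional e.
  rewrite -ge; apply: (cvgr_to_le (ue g dg)); apply: nearW => k.
  by apply: le_trans (ler_norm _) _; rewrite -(u1 (phi k)); exact: gn.
have [s s0 Ns] := exN e e0.
exists (s *: e) => // y Ny; apply: (@le_trans _ _ (inf L)); last first.
  by apply: ge_inf => //; exists y.
apply: le_trans (lim_le s (ltW s0)); rewrite energy_ray lerD2r.
rewrite ler_piMr// ?expr_le1//.
by rewrite mulr_ge0// exprn_ge0// ltW.
Qed.

End energy.

(** * The critical point and its min-max characterizations *)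

Theorem theorem2p1 (R : realType) (E : completeNormedModType R) (I : E -> R^o)
  (E_neq0 : exists x : E, x != 0)
  (E_reflexive : reflexive_space E)
  (I_C1 : class_C1 I)
  (Phi_C1 : class_C1 (energy I))
  (I_weak : weakly_seq_continuous I)
  (I_at0 : I x / `|x| ^+ 2 @[x --> (0 : E)^'] --> (0 : R))
  (I_superquadratic : forall K : set E, weakly_compact K -> K `<=` [set~ 0] ->
     forall A : R, \forall s \near +oo,
       forall x : E, K x -> A <= I (s *: x) / s ^+ 2)
  (I_monotone : forall x : E, x != 0 -> forall s t : R, 0 < s -> s <= t ->
     'd I (s *: x) x / s <= 'd I (t *: x) x / t) :
  let Phi := energy I in
  exists xbar : E,
    [/\ critical_point Phi xbar,
        maximums (ray_values Phi xbar) (Phi xbar),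
        (forall e : E, `|e| = 1 -> maximums (ray_values Phi e) !=set0) /\
        infimums [set m : R | exists2 e : E, `|e| = 1 &
                    maximums (ray_values Phi e) m] (Phi xbar),
        infimums [set Phi x | x in nehari Phi] (Phi xbar)
      & 0 < Phi xbar].
Proof.
move=> Phi.
have mono := energy_monotone I_C1 Phi_C1 I_monotone.
have ray_le0 := energy_ray_nonpositive I_superquadratic.
have [r [m [r0 m0 sphere]]] := energy_sphere I_at0.
have f0 : Phi 0 = 0.
  by rewrite /Phi /energy (I0_eq0 I_C1 I_at0 E_neq0) normr0 expr0n mulr0 subr0.
have level := nehari_level Phi_C1 mono r0 sphere.
have [x Nx xmin] := energy_nehari_minimizer I_C1 Phi_C1 I_at0 E_neq0 E_reflexive
  I_weak I_superquadratic I_monotone.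
have [s [fs crit]] :=
  nehari_minimizer_critical Phi_C1 mono f0 r0 m0 sphere ray_le0 Nx xmin.
exists (s *: x); rewrite -/Phi in crit fs *.
have Phi_gt0 : 0 < Phi (s *: x) by rewrite fs; exact: lt_le_trans m0 (level x Nx).
have sx0 : s *: x != 0.
  by apply/eqP => sx; move: Phi_gt0; rewrite sx f0 ltxx.
have Nsx : nehari Phi (s *: x) by split.
have minPhi y : nehari Phi y -> Phi (s *: x) <= Phi y by rewrite fs; exact: xmin.
have nx0 : 0 < `|s *: x| by rewrite normr_gt0.
have maxPhi y t : 0 < t -> nehari Phi (t *: y) -> maximums (ray_values Phi y) (Phi (t *: y)).
  exact: (nehari_ray_maximum Phi_C1 mono).
have ex_max (e : E) : `|e| = 1 -> exists2 t : R, 0 < t & nehari Phi (t *: e).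
  move=> e1; apply: (nehari_exists Phi_C1 f0 r0 m0 sphere ray_le0).
  by rewrite -normr_eq0 e1 oner_neq0.
split=> //.
- by have := maxPhi (s *: x) 1 ltr01; rewrite scale1r => /(_ Nsx).
- split=> [e /ex_max[t t0 Nt]|]; first by exists (Phi (t *: e)); exact: maxPhi.
  (* Each ray maximum dominates the value at a Nehari point of that ray; the infimum is attained in
     the direction of [s *: x]. *)
  split=> [l [e /ex_max[t t0 Nt] [_ ub]]|b bl].
    by apply: le_trans (minPhi _ Nt) (ub _ _); exists t => //; exact: ltW.
  have sxE : `|s *: x| *: (`|s *: x|^-1 *: (s *: x)) = s *: x.
    by rewrite scalerA divff ?scale1r// gt_eqF.
  apply: bl; exists (`|s *: x|^-1 *: (s *: x)).
    by rewrite normrZ normfV normr_id mulVf// gt_eqF.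
  by have := maxPhi (`|s *: x|^-1 *: (s *: x)) _ nx0; rewrite sxE => /(_ Nsx).
- split=> [_ [y Ny <-]|b bl]; first exact: minPhi.
  by apply: bl; exists (s *: x).
Qed.
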